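(* Assume that $\mu_\beta$ satisfies (G1) and (G2), and let $\lambda^1,\dots,\lambda^K$, $\lambda^k=(\lambda^k_{jl})_{jl}$, be a basis of the subspace $Q$. Then for every integer $J'\ge0$, every $v\in\mathcal{V}[J']$, every $\mathcal{J}\subseteq\{1,\dots,J\}$, every $\ell\in\mathcal{L}^{[\mathcal{J}]}$, every $j\in\mathcal{J}$ and every $l\in\{1,\dots,L_j\}$, $$\sum_{k=1}^K\lambda^k_{jl}\cdot\Big(M_\ell(\mu_\beta)\cdot\mathcal{E}(G^{v+\mathbf{1}_k}\mid X=\ell)\Big)=M_{\ell+\boldsymbol{l}_j}(\mu_\beta)\cdot\mathcal{E}(G^v\mid X=\ell+\boldsymbol{l}_j).$$
   Context: Setting: $J\ge1$ and $L=(L_1,\dots,L_J)$ are positive integers, $|L|=\sum_jL_j$; coordinates of $\mathbb{R}^{|L|}$ are indexed by pairs $(j,l)$, $1\le j\le J$, $1\le l\le L_j$. $\mathbb{S}^L=\{\beta\in\mathbb{R}^{|L|}:\beta_{jl}\ge0,\ \sum_l\beta_{jl}=1\text{ for all }j\}$. $\mu_\beta$ is a Borel probability measure on $\mathbb{R}^{|L|}$ with $\mu_\beta(\mathbb{S}^L)=1$. $\beta$ is a random vector with law $\mu_\beta$, and $X=(X_1,\dots,X_J)$ is a random vector, $X_j\in\{1,\dots,L_j\}$, with $\Pr(X_j=l\mid\beta)=\beta_{jl}$. (G1): conditionally on $\beta$, $X_1,\dots,X_J$ are mutually independent. (G2): there is a $K$-dimensional linear subspace $Q\subseteq\mathbb{R}^{|L|}$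 with $\mu_\beta(Q)=1$ such that no proper linear subspace of $Q$ has $\mu_\beta$-measure $1$. Indices: $\mathcal{L}^0=\{\ell\in\mathbb{Z}^J:0\le\ell_j\le L_j\}$; $\mathcal{L}^{[\mathcal{J}]}=\{\ell\in\mathcal{L}^0:\ell_j=0\Leftrightarrow j\in\mathcal{J}\}$. The vector $\boldsymbol{l}_j\in\mathbb{Z}^J$ has $j$-th component $l$ and other components $0$; $\mathbf{1}_k\in\mathbb{Z}^K$ is the $k$-th unit vector. $\mathcal{V}[J']=\{v\in\mathbb{Z}_{\ge0}^K:\sum_kv_k=J'\}$. $M_\ell(\mu_\beta)=\int\prod_{j:\ell_j\ne0}\beta_{j\ell_j}\,\mu_\beta(d\beta)$. $G=(G_1,\dots,G_K)$ is the coordinate vector of $\beta$ in the given basis, $\beta=\sum_kG_k\lambda^k$. For $\ell\in\mathcal{L}^{[\mathcal{J}]}$, ''$X=\ell$'' means $X_j=\ell_j$ for all $j\notin\mathcal{J}$; $\mathcal{E}(\cdot\mid\cdot)$ is conditional expectation and $G^v=\prod_kG_k^{v_k}$. If $M_\ell(\mu_\beta)=\Pr(X=\ell)=0$, the product $M_\ell(\mu_\beta)\cdot\mathcal{E}(G^v\mid X=\ell)$ is read as $0$. *)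

(* Defs.v *)
From HB Require Import structures.
From mathcomp Require Import all_boot all_order all_algebra.
From mathcomp Require Import all_classical all_reals all_analysis.

Set Implicit Arguments.
Unset Strict Implicit.
Unset Printing Implicit Defensive.

Import Order.TTheory GRing.Theory Num.Theory.
Import numFieldNormedType.Exports.

Local Open Scope classical_set_scope.
Local Open Scope ring_scope.

(* R^n with its Borel sigma-algebra; the carrier is 'rV[R]_n itself, so the
   vector-space notions apply to its elements. *)
Notation borel_rV R n := (g_sigma_algebraType (@open 'rV[R]_n)).

(* The coordinate x_{jl} of x in R^{|L|}, where |L| = \sum_j L j.  The index l
   is 1-based, as in the mathematics; the value is 0 when l is not in
   {1, ..., L j}. *)
Definition entry (R : realType) (J : nat) (L : 'I_J -> nat)
    (x : 'rV[R]_(\sum_(j < J) L j)) (j : 'I_J) (l : nat) : R :=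
  if [pick i : 'I_(L j) | i.+1 == l] is Some i
  then x 0 (@tagnat.Rank J L j i) else 0.

(* The product of simplices S^L. *)
Definition simplexL (R : realType) (J : nat) (L : 'I_J -> nat) :
    set 'rV[R]_(\sum_(j < J) L j) :=
  [set x | forall j : 'I_J,
     (forall l : nat, (1 <= l <= L j)%N -> 0 <= entry x j l) /\
     \sum_(1 <= l < (L j).+1) entry x j l = 1].

(* Z is a version of the conditional probability P(A | Y). *)
Definition is_cond_prob (R : realType) (d d' : measure_display)
    (T : measurableType d) (T' : measurableType d') (P : probability T R)
    (Y : {mfun T >-> T'}) (A : set T) (Z : T -> R) : Prop :=
  [/\ measurable_fun [set: g_sigma_algebra_preimageType Y] Z,
      P.-integrable [set: T] (EFin \o Z) &
      forall B : set T, g_sigma_algebra_preimage Y B ->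
        (\int[P]_(w in B) (Z w)%:E)%E = P (A `&` B)].

(* Mutual independence of the discrete variables X_1, ..., X_J conditionally
   on Y.  Subfamilies are covered by taking some of the A j to be setT; the
   choice of the versions p j is immaterial, since they are a.s. unique. *)
Definition cond_mutually_independent (R : realType) (d d' : measure_display)
    (T : measurableType d) (T' : measurableType d') (P : probability T R)
    (Y : {mfun T >-> T'}) (J : nat) (X : 'I_J -> {mfun T >-> nat}) : Prop :=
  forall (A : 'I_J -> set nat) (p : 'I_J -> T -> R),
    (forall j, is_cond_prob P Y (X j @^-1` A j) (p j)) ->
    is_cond_prob P Y [set w | forall j, A j (X j w)]
      (fun w => \prod_(j < J) p j w).

(* Q is a K-dimensional subspace carrying mu, and no proper subspace of Q
   does. *)
Definition minimal_support (R : realType) (n : nat)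
    (mu : probability (borel_rV R n) R) (K : nat) (Q : {vspace 'rV[R]_n}) :
    Prop :=
  [/\ \dim Q = K,
      mu [set x : 'rV[R]_n | x \in Q] = 1%E &
      forall Q' : {vspace 'rV[R]_n}, (Q' <= Q)%VS -> Q' != Q ->
        mu [set x : 'rV[R]_n | x \in Q'] <> 1%E].

Definition indexL (J : nat) (L : 'I_J -> nat) (S : {set 'I_J})
    (ell : 'I_J -> nat) : Prop :=
  (forall j, (ell j <= L j)%N) /\ (forall j, (ell j == 0%N) = (j \in S)).

(* ell + l_j, where l_j has j-th component l and other components 0. *)
Definition add_at (J : nat) (ell : 'I_J -> nat) (j : 'I_J) (l : nat) :
    'I_J -> nat :=
  fun i => (ell i + (if i == j then l else 0))%N.

Definition add_unit (K : nat) (v : 'I_K -> nat) (k : 'I_K) : 'I_K -> nat :=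
  fun i => (v i + (i == k))%N.

Definition moment (R : realType) (J : nat) (L : 'I_J -> nat)
    (mu : probability (borel_rV R (\sum_(j < J) L j)) R)
    (ell : 'I_J -> nat) : R :=
  Rintegral mu setT (fun b : 'rV[R]_(\sum_(j < J) L j) =>
    \prod_(j < J | ell j != 0%N) entry b j (ell j)).

(* The event "X = ell": components where ell vanishes are not constrained. *)
Definition eventX (T : Type) (J : nat) (X : 'I_J -> T -> nat)
    (ell : 'I_J -> nat) : set T :=
  [set w | forall j, ell j != 0%N -> X j w = ell j].

(* E(Z | A); the value is 0 when P A = 0, since then the divisor is 0. *)
Definition cond_expect (R : realType) (d : measure_display)
    (T : measurableType d) (P : probability T R) (Z : T -> R) (A : set T) : R :=
  Rintegral P A Z / fine (P A).

(* G^v, with G the coordinates of x in lambda.  Off the span of lambda, the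
   linear forms coord are those of the library; this concerns only a null set
   in what follows. *)
Definition coord_monomial (R : realType) (n K : nat)
    (lambda : K.-tuple 'rV[R]_n) (v : 'I_K -> nat) (x : 'rV[R]_n) : R :=
  \prod_(k < K) coord lambda k x ^+ v k.

(* Main.v *)
Require Import Defs.
From HB Require Import structures.
From mathcomp Require Import all_boot all_order all_algebra.
From mathcomp Require Import all_classical all_reals all_analysis.
From mathcomp Require Import measurable_realfun.
From mathcomp Require Import ring.

Set Implicit Arguments.
Unset Strict Implicit.
Unset Printing Implicit Defensive.

Import Order.TTheory GRing.Theory Num.Theory.
Import numFieldNormedType.Exports.

Local Open Scope classical_set_scope.
Local Open Scope ring_scope.

(** The identity is what remains of the pointwise relation
    beta_jl = sum_k lambda^k_jl G_k, valid almost surely because beta lies in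
    the span Q of the lambda^k, once it is multiplied by
    G^v * prod_(i : ell_i != 0) beta_(i, ell_i) and integrated.

    For this one needs that the product of a moment and a conditional
    expectation is such an integral: M_ell * E(f(beta) | X = ell) equals
    E(f(beta) * prod_(i : ell_i != 0) beta_(i, ell_i))
    ([moment_cond_expect]).  Conditional independence says that the product
    prod_(i : ell_i != 0) beta_(i, ell_i), called [cell_prob ell beta] below,
    is a version of P(X = ell | beta) ([is_cond_prob_eventX]).  Its mean is
    therefore both P(X = ell) and M_ell, so M_ell cancels the denominator of
    the conditional expectation, and the integral of f(beta) over the event
    X = ell can be computed by inserting the conditional probability as a
    density ([integral_cond_prob]).

    Since ell_j = 0, passing from ell to ell + l_j multiplies the product by
    exactly beta_jl ([cell_prob_add_at]), which is then expanded in the basis.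
    All integrands are almost surely bounded, because beta lies in a product of
    simplices and the coordinates G_k are linear in beta; this allows the
    finite sum over k to be exchanged with the integral. *)

(** * Densities relative to a random element *)

Section density.
Context (R : realType) (d d' : measure_display).
Context (T : measurableType d) (T' : measurableType d').
Context (P : {measure set T -> \bar R}) (Y : {mfun T >-> T'}).
Variables (A : set T) (Z : T -> R).
Hypotheses (mA : measurable A) (mZ : measurable_fun [set: T] Z).
Hypothesis Z_ge0 : forall w, 0 <= Z w.
Hypothesis intZ : forall B : set T', measurable B ->
  (\int[P]_(w in Y @^-1` B) (Z w)%:E)%E = P (A `&` Y @^-1` B).

Import HBNNSimple.
Local Open Scope ereal_scope.

Let mY (B : set T') : measurable B -> measurable (Y @^-1` B).
Proof. by move=> mB; rewrite -(setTI (_ @^-1` _)); exact: measurable_funP. Qed.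

Let mZE : measurable_fun [set: T] (EFin \o Z).
Proof. exact/measurable_EFinP. Qed.

(** By linearity this is the hypothesis [intZ], applied to the level sets of f
    pulled back along Y. *)
Lemma nnsfun_integral_density (f : {nnsfun T' >-> R}) :
  \int[P]_(w in A) (f (Y w))%:E = \int[P]_w ((f (Y w))%:E * (Z w)%:E).
Proof.
have mf k : measurable (Y @^-1` (f @^-1` [set k])) by exact: mY.
have m1 k : measurable_fun [set: T] (\1_(Y @^-1` (f @^-1` [set k])) : T -> R).
  exact: measurable_indic.
have fE w : (f (Y w))%:E =
    \sum_(k \in range f) (k * \1_(Y @^-1` (f @^-1` [set k])) w)%:E.
  by rewrite fimfunE -fsumEFin.
have f0 k w : 0 <= (k * \1_(Y @^-1` (f @^-1` [set k])) w)%:E.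
  exact: (nnfun_muleindic_ge0 f k (Y w)).
under eq_integral do rewrite fE.
rewrite ge0_integral_fsum//; last first.
  by move=> k; apply/measurable_EFinP/measurable_funM.
under [RHS]eq_integral => w _.
  rewrite fE ge0_mule_fsuml//.
  over.
rewrite ge0_integral_fsum//; last 2 first.
- move=> k; apply: emeasurable_funM => //.
  exact/measurable_EFinP/measurable_funM.
- by move=> k w _; rewrite mule_ge0// lee_fin.
apply: eq_fsbigr => k _.
rewrite (integralZl_indic _ (fun k => Y @^-1` (f @^-1` [set k])))//; last first.
  by move=> k0; rewrite preimage_nnfun0.
rewrite integral_indic// setIC -intZ//.
(* A negative k is not a value of f; its level set is empty. *)
have [k0|k0] := ltP k 0%R.
  rewrite preimage_nnfun0// preimage_set0 integral_set0 mule0.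
  by rewrite integral0_eq// => w _; rewrite indic0 mulr0 mul0e.
rewrite integral_mkcond -ge0_integralZl//.
- apply: eq_integral => w _.
  by rewrite epatch_indic EFinM -muleA [in RHS](muleC (\1_ _ w)%:E).
- by apply/(measurable_restrictT _ _).1 => //; exact: measurable_funTS.
- by move=> w _; apply: erestrict_ge0 => ? _; rewrite lee_fin.
Qed.

(** Monotone convergence extends the case of simple functions.  Real values of
    Z are what makes f_n * Z converge to f * Z even where f is infinite. *)
Lemma ge0_integral_density (f : T' -> \bar R) :
  measurable_fun [set: T'] f -> (forall y, 0 <= f y) ->
  \int[P]_(w in A) f (Y w) = \int[P]_w (f (Y w) * (Z w)%:E).
Proof.
move=> mf f0; pose f_ := nnsfun_approx measurableT mf.
have cvg_f w : (f_ n (Y w))%:E @[n --> \oo] --> f (Y w).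
  exact: cvg_nnsfun_approx.
have nd_f w m n : (m <= n)%N -> (f_ m (Y w) <= f_ n (Y w))%R.
  by move=> mn; exact/lefP/nd_nnsfun_approx.
have mfY n : measurable_fun [set: T] (fun w => (f_ n (Y w))%:E).
  by apply/measurable_EFinP; exact: measurableT_comp.
transitivity (limn (fun n => \int[P]_(w in A) (f_ n (Y w))%:E)).
  rewrite -monotone_convergence//.
  - by apply: eq_integral => w _; apply/esym/cvg_lim.
  - by move=> n; exact: measurable_funTS.
  - by move=> n w _; rewrite lee_fin.
  - by move=> w _ m n mn; rewrite lee_fin nd_f.
under eq_fun do rewrite nnsfun_integral_density.
rewrite -monotone_convergence//.
- apply: eq_integral => w _; apply/cvg_lim => //.
  by apply: cvgeZr; [|exact: cvg_f].
- by move=> n; exact: emeasurable_funM.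
- by move=> n w _; rewrite mule_ge0// lee_fin.
- by move=> w _ m n mn; rewrite lee_wpmul2r// lee_fin ?nd_f.
Qed.

End density.

(** * Integrals over an event as integrals of conditional probabilities *)

Section cond_prob.
Context (R : realType) (d d' : measure_display).
Context (T : measurableType d) (T' : measurableType d').
Context (P : probability T R) (Y : {mfun T >-> T'}).

(** Replacing h by its absolute value changes nothing almost surely and makes
    it a nonnegative density, which commutes with positive and negative parts of
    f; both sides are then the same difference of extended reals. *)
Lemma integral_cond_prob (A : set T) (h f : T' -> R) :
  measurable A ->
  measurable_fun [set: T'] h -> {ae P, forall w, 0 <= h (Y w)} ->
  is_cond_prob P Y A (h \o Y) ->
  measurable_fun [set: T'] f ->
  (\int[P]_(w in A) (f (Y w))%:E = \int[P]_w (f (Y w) * h (Y w))%:E)%E.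
Proof.
move=> mA mh h0 [_ _ hA] mf.
have mhY : measurable_fun [set: T] (h \o Y) by exact: measurableT_comp.
have mfY : measurable_fun [set: T] (f \o Y) by exact: measurableT_comp.
pose Z w := `|h (Y w)|.
have Z0 w : 0 <= Z w by exact: normr_ge0.
have mZ : measurable_fun [set: T] Z by exact: measurableT_comp.
have ZE (g : T -> R) D :
    ae_eq P D (fun w => (g w * h (Y w))%:E) (fun w => (g w * Z w)%:E).
  by apply: filterS h0 => w h0 _; rewrite /Z ger0_norm.
have intZ (B : set T') : measurable B ->
    (\int[P]_(w in Y @^-1` B) (Z w)%:E)%E = P (A `&` Y @^-1` B).
  move=> mB; have mYB : measurable (Y @^-1` B).
    by rewrite -(setTI (_ @^-1` _)); exact: measurable_funP.
  rewrite -hA; last by exists B => //; rewrite setTI.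
  apply: ae_eq_integral => //.
  - by apply/measurable_EFinP; exact: measurable_funTS.
  - by apply/measurable_EFinP; exact: measurable_funTS.
  - by apply: filterS h0 => w h0 _; rewrite /Z ger0_norm.
rewrite (_ : (\int[P]_w (f (Y w) * h (Y w))%:E =
    \int[P]_w (f (Y w) * Z w)%:E)%E); last first.
  apply: ae_eq_integral => //.
  - by apply/measurable_EFinP; exact: measurable_funM.
  - by apply/measurable_EFinP; exact: measurable_funM.
have mfE : measurable_fun [set: T'] (EFin \o f) by exact/measurable_EFinP.
rewrite [LHS]integralE [RHS]integralE; congr (_ - _)%E.
- transitivity (\int[P]_w ((EFin \o f)^\+ (Y w) * (Z w)%:E))%E.
    rewrite -(ge0_integral_density mA mZ Z0 intZ
      (measurable_funepos mfE) (funepos_ge0 _)).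
    by apply: eq_integral => w _; rewrite !funeposE.
  apply: eq_integral => w _; rewrite !funeposE EFinM.
  by rewrite -[in RHS](mul0e (Z w)%:E) maxe_pMl// lee_fin normr_ge0.
- transitivity (\int[P]_w ((EFin \o f)^\- (Y w) * (Z w)%:E))%E.
    rewrite -(ge0_integral_density mA mZ Z0 intZ
      (measurable_funeneg mfE) (funeneg_ge0 _)).
    by apply: eq_integral => w _; rewrite !funenegE.
  apply: eq_integral => w _; rewrite !funenegE EFinM -mulNe.
  by rewrite -[in RHS](mul0e (Z w)%:E) maxe_pMl// lee_fin normr_ge0.
Qed.

Lemma ae_bounded_integrable (f : T -> R) (M : R) :
  measurable_fun [set: T] f -> {ae P, forall w, `|f w| <= M} ->
  P.-integrable [set: T] (EFin \o f).
Proof.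
move=> mf fM; apply/integrableP; split; first exact/measurable_EFinP.
apply: (@le_lt_trans _ _ (`|M|%:E * P setT)%E).
  apply: integral_le_bound => //; first exact/measurable_EFinP.
  by apply: filterS fM => w fM _; rewrite lee_fin (le_trans fM)// ler_norm.
by rewrite probability_setT mule1 ltry.
Qed.

Lemma full_law_ae (mu : probability T' R) (D : set T') :
  (forall B : set T', measurable B -> distribution P Y B = mu B) ->
  measurable D -> mu D = 1%E -> {ae P, forall w, D (Y w)}.
Proof.
move=> YL mD D1; exists (Y @^-1` (~` D)); split => //.
- by rewrite -(setTI (_ @^-1` _)); apply: measurable_funP => //; exact: measurableC.
- rewrite -[LHS]/(distribution P Y (~` D)) YL; last exact: measurableC.
  by rewrite probability_setC// D1 subee.
Qed.

Lemma measurable_forall_fin (I : finType) (F : I -> set T) :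
  (forall i, measurable (F i)) -> measurable [set w | forall i, F i w].
Proof.
move=> mF; rewrite (_ : [set _ | _] = \bigcap_(i in [set: I]) F i).
  exact: fin_bigcap_measurable.
by apply/seteqP; split=> w /= Fw i; [move=> _|]; exact: Fw.
Qed.

End cond_prob.

(** * Linear forms and subspaces in the Borel structure of row vectors *)

Section borel_row_vectors.
Context (R : realType).

Lemma measurable_coord_rV n (i : 'I_n) :
  measurable_fun [set: borel_rV R n] (fun x : 'rV[R]_n => x 0 i).
Proof.
apply: (measurability _ (RGenOpens.measurableE R)).
move=> _ [_ [a [b ->] <-]]; rewrite setTI; apply: sub_sigma_algebra.
have /continuousP := @coord_continuous R 1 n 0 i; apply.
exact: interval_open.
Qed.

Lemma row_functionalE n (phi : {scalar 'rV[R]_n}) (x : 'rV[R]_n) :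
  phi x = \sum_(i < n) x 0 i * phi (delta_mx 0 i).
Proof.
rewrite [in LHS](row_sum_delta x) linear_sum.
by apply: eq_bigr => i _; rewrite linearZ.
Qed.

Lemma measurable_row_functional n (phi : {scalar 'rV[R]_n}) :
  measurable_fun [set: borel_rV R n] (phi : 'rV[R]_n -> R).
Proof.
rewrite (_ : (phi : _ -> _) =
  (fun x : 'rV[R]_n => \sum_(i < n) x 0 i * phi (delta_mx 0 i))).
  apply: measurable_sum => i; apply: measurable_funM => //.
  exact: measurable_coord_rV.
by apply/funext => x; exact: row_functionalE.
Qed.

(** A vector lies in Q exactly when it agrees, entry by entry, with its
    expansion in a basis of Q; this is a finite system of measurable equations.
    Measurability is what allows a probability of 1 to be read as an almost
    sure statement. *)
Lemma measurable_vspace n (Q : {vspace 'rV[R]_n}) :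
  measurable ([set x : 'rV[R]_n | x \in Q] : set (borel_rV R n)).
Proof.
pose pr (x : 'rV[R]_n) : 'rV[R]_n := \sum_k coord (vbasis Q) k x *: (vbasis Q)`_k.
rewrite (_ : [set _ | _] =
    [set x : 'rV[R]_n | forall i : 'I_n, (x 0 i - pr x 0 i) = 0]).
  apply: measurable_forall_fin => i.
  have mf : measurable_fun [set: borel_rV R n]
      (fun x : 'rV[R]_n => x 0 i - pr x 0 i).
    apply: measurable_funB; first exact: measurable_coord_rV.
    under eq_fun do rewrite /pr summxE.
    apply: measurable_sum => k; under eq_fun do rewrite mxE.
    by apply: measurable_funM => //; exact: measurable_row_functional.
  have := mf measurableT [set 0] (measurable_set1 _); rewrite setTI; exact.
apply/seteqP; split => x /= xQ; last first.
  suff -> : x = pr x.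
    by apply: memv_suml => k _; apply/memvZ/vbasis_mem/mem_nth; rewrite size_tuple.
  by apply/rowP => i; apply/eqP; rewrite -subr_eq0 xQ.
have -> : pr x = x by rewrite [RHS](coord_vbasis xQ).
by move=> i; rewrite subrr.
Qed.

Lemma row_functional_bound n (phi : {scalar 'rV[R]_n}) (x : 'rV[R]_n) :
  (forall i, `|x 0 i| <= 1) -> `|phi x| <= \sum_(i < n) `|phi (delta_mx 0 i)|.
Proof.
move=> x1; rewrite row_functionalE (le_trans (ler_norm_sum _ _ _))//.
by apply: ler_sum => i _; rewrite normrM ler_piMl.
Qed.

Lemma measurable_coord_monomial n K (lambda : K.-tuple 'rV[R]_n) v :
  measurable_fun [set: borel_rV R n] (coord_monomial lambda v).
Proof.
apply: measurable_prod => k _; apply: measurable_funX.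
exact: measurable_row_functional.
Qed.

(** On the cube [-1, 1]^n each linear form is bounded by the sum of its absolute
    values on the standard basis. *)
Lemma coord_monomial_bound n K (lambda : K.-tuple 'rV[R]_n) v :
  exists M, forall x : 'rV[R]_n, (forall i, `|x 0 i| <= 1) ->
    `|coord_monomial lambda v x| <= M.
Proof.
exists (\prod_(k < K) (\sum_(i < n) `|coord lambda k (delta_mx 0 i)|) ^+ v k).
move=> x x1; rewrite normr_prod; apply: ler_prod => k _.
rewrite normr_ge0 normrX lerXn2r ?nnegrE ?sumr_ge0//.
exact: row_functional_bound.
Qed.

Lemma coord_monomialS n K (lambda : K.-tuple 'rV[R]_n) v k (x : 'rV[R]_n) :
  coord_monomial lambda (add_unit v k) x =
  coord_monomial lambda v x * coord lambda k x.
Proof.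
rewrite /coord_monomial (bigD1 k)//= [in RHS](bigD1 k)//= /add_unit eqxx addn1.
rewrite exprSr -!mulrA; congr (_ * _).
rewrite [RHS]mulrC; congr (_ * _); apply: eq_bigr => i /negPf ik.
by rewrite ik addn0.
Qed.

End borel_row_vectors.

(** * Cell probabilities on the product of simplices *)

Section product_of_simplices.
Context (R : realType) (J : nat) (L : 'I_J -> nat).
Local Notation V := 'rV[R]_(\sum_(j < J) L j).
Local Notation borelV := (borel_rV R (\sum_(j < J) L j)).
Implicit Types (b : V).

Lemma entry_Rank b j (i : 'I_(L j)) :
  entry b j i.+1 = b 0 (@tagnat.Rank J L j i).
Proof.
rewrite /entry; case: pickP => [i' /eqP [/val_inj ->]//|/(_ i)].
by rewrite eqxx.
Qed.

Lemma entry_sum K (c : 'I_K -> R) (e : 'I_K -> V) j l :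
  entry (\sum_k c k *: e k) j l = \sum_k c k * entry (e k) j l.
Proof.
rewrite /entry; case: pickP => [i _|_]; last first.
  by rewrite big1// => k _; rewrite mulr0.
by rewrite summxE; apply: eq_bigr => k _; rewrite mxE.
Qed.

Lemma measurable_entry j l :
  measurable_fun [set: borelV] (fun b : V => entry b j l).
Proof.
rewrite /entry; case: pickP => [i _|_] //; exact: measurable_coord_rV.
Qed.

Lemma measurable_simplexL : measurable (@simplexL R J L : set borelV).
Proof.
apply: measurable_forall_fin => j; apply: measurableI; last first.
  have mf : measurable_fun [set: borelV]
      (fun b : V => \sum_(1 <= l < (L j).+1) entry b j l).
    by apply: measurable_sum => l; exact: measurable_entry.
  have := mf measurableT [set 1] (measurable_set1 _); rewrite setTI; exact.
rewrite [X in measurable X](_ : _ = \bigcap_(l in [set l | (1 <= l <= L j)%N])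
  [set b : V | 0 <= entry b j l]); last first.
  by apply/seteqP; split=> b b0 l lL; exact: b0.
apply: bigcap_measurableType => l _.
have := @measurable_entry j l measurableT `[0, +oo[%classic (measurable_itv _).
rewrite setTI; congr measurable.
by apply/seteqP; split=> b /=; rewrite in_itv/= andbT.
Qed.

(** For l outside 1, ..., L j the entry is 0 by convention. *)
Lemma simplexL_entry_ge0 b j l : simplexL b -> 0 <= entry b j l.
Proof.
move=> /(_ j)[b0 _]; have [|lL] := boolP (1 <= l <= L j)%N; first exact: b0.
rewrite /entry; case: pickP => // i /eqP il.
by rewrite -il ltn_ord in lL.
Qed.

Lemma simplexL_entry_le1 b j l : simplexL b -> entry b j l <= 1.
Proof.
move=> bS; have [_ <-] := bS j; have [lL|lL] := boolP (1 <= l <= L j)%N.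
  rewrite (bigD1_seq l) ?mem_index_iota ?ltnS ?iota_uniq//= lerDl.
  by rewrite sumr_ge0// => ? _; exact: simplexL_entry_ge0.
rewrite [leLHS](_ : _ = 0).
  by rewrite sumr_ge0// => ? _; exact: simplexL_entry_ge0.
rewrite /entry; case: pickP => // i /eqP il.
by rewrite -il ltn_ord in lL.
Qed.

Lemma simplexL_coord_le1 b i : simplexL b -> `|b 0 i| <= 1.
Proof.
move=> bS; rewrite -(@tagnat.sig2K J L i) -entry_Rank.
by rewrite ger0_norm ?simplexL_entry_ge0// simplexL_entry_le1.
Qed.

(** The conditional probability of the cell X = ell given beta = b, in the
    form that independence gives it.  Its integral is [moment]. *)
Definition cell_prob (ell : 'I_J -> nat) b : R :=
  \prod_(j < J | ell j != 0%N) entry b j (ell j).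

Lemma measurable_cell_prob ell : measurable_fun [set: borelV] (cell_prob ell).
Proof.
rewrite (_ : cell_prob ell = fun b =>
    \prod_(j < J) if ell j != 0%N then entry b j (ell j) else 1); last first.
  by apply/funext => b; rewrite /cell_prob [LHS]big_mkcond.
apply: measurable_prod => j _; case: (ell j != 0%N) => //; exact: measurable_entry.
Qed.

Lemma cell_prob_ge0 ell b : simplexL b -> 0 <= cell_prob ell b.
Proof. by move=> bS; apply: prodr_ge0 => j _; exact: simplexL_entry_ge0. Qed.

Lemma cell_prob_le1 ell b : simplexL b -> cell_prob ell b <= 1.
Proof.
move=> bS; apply: prodr_ile1 => j _.
by rewrite simplexL_entry_ge0// simplexL_entry_le1.
Qed.

(** As ell j = 0, the factor of index j is absent from the product for ell and
    is the only new one in the product for ell + l_j. *)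
Lemma cell_prob_add_at ell j l b : ell j = 0%N -> (0 < l)%N ->
  cell_prob (add_at ell j l) b = entry b j l * cell_prob ell b.
Proof.
move=> ell0 l0; rewrite /cell_prob (bigD1 j)/=; last first.
  by rewrite /add_at eqxx ell0 add0n -lt0n.
rewrite {1}/add_at eqxx ell0 add0n; congr (_ * _).
apply: eq_big => i; rewrite /add_at.
  by have [->|ij] := eqVneq i j; rewrite ?ell0 ?addn0 ?andbF ?andbT.
by move=> /andP[_ /negPf ->]; rewrite addn0.
Qed.

End product_of_simplices.

(** * Moments and conditional expectations *)

Section latent_class.
Context (R : realType) (J : nat) (L : 'I_J -> nat).
Local Notation borelV := (borel_rV R (\sum_(j < J) L j)).
Context (mu : probability borelV R).
Context (d : measure_display) (Omega : measurableType d).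
Context (P : probability Omega R) (beta : {mfun Omega >-> borelV}).
Hypothesis beta_law : forall B : set borelV,
  measurable B -> distribution P beta B = mu B.
Context (X : 'I_J -> {mfun Omega >-> nat}).
Hypothesis X_given_beta : forall (j : 'I_J) (l : nat), (1 <= l <= L j)%N ->
  is_cond_prob P beta (X j @^-1` [set l]) (fun w => entry (beta w) j l).
Hypothesis G1 : cond_mutually_independent P beta X.
Hypothesis mu_simplex : mu (@simplexL R J L) = 1%E.

Lemma simplexL_ae : {ae P, forall w, simplexL (beta w : 'rV[R]__)}.
Proof. exact: full_law_ae beta_law (@measurable_simplexL R J L) mu_simplex. Qed.

Lemma measurable_eventX ell : measurable (eventX X ell).
Proof.
apply: measurable_forall_fin => j; have [ellj|_] := boolP (ell j != 0%N).
  rewrite (_ : (fun _ => _) = X j @^-1` [set ell j]).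
    by rewrite -(setTI (_ @^-1` _)); exact: measurable_funP.
  by apply/seteqP; split=> w //=; exact.
by rewrite (_ : (fun _ => _) = setT)//; apply/seteqP; split.
Qed.

Lemma is_cond_prob_setT : is_cond_prob P beta [set: Omega] (cst 1).
Proof.
split; first exact: measurable_cst.
  exact: finite_measure_integrable_cst.
move=> B [B' mB' <-]; rewrite !setTI -[RHS]mul1e -integral_cst//.
by rewrite -(setTI (_ @^-1` _)); exact: measurable_funP.
Qed.

(** Conditional independence is used with the constraint X_j = ell_j where
    ell_j is nonzero and with the trivial constraint, of conditional
    probability 1, where it vanishes. *)
Lemma is_cond_prob_eventX ell : (forall j, (ell j <= L j)%N) ->
  is_cond_prob P beta (eventX X ell) (cell_prob ell \o beta).
Proof.
move=> ellL; pose A j := if ell j != 0%N then [set ell j] else [set: nat].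
pose p j w := if ell j != 0%N then entry (beta w) j (ell j) else 1.
have := G1 (A := A) (p := p).
rewrite (_ : [set w | _] = eventX X ell); last first.
  apply/seteqP; split=> w /= Aw j; last by rewrite /A; case: ifPn => // /Aw.
  by move=> ellj; have := Aw j; rewrite /A ellj.
rewrite (_ : (fun w => _) = cell_prob ell \o beta); last first.
  by apply/funext => w; rewrite /cell_prob /= [RHS]big_mkcond.
apply=> j; rewrite /A /p; case: ifPn => ellj; last first.
  exact: is_cond_prob_setT.
by apply: X_given_beta; rewrite lt0n ellj ellL.
Qed.

(** Both sides are the mean of the cell probability: the left one computed
    under the law of beta, the right one by conditioning. *)
Lemma moment_eventX ell : (forall j, (ell j <= L j)%N) ->
  moment mu ell = fine (P (eventX X ell)).
Proof.
move=> ellL; have [_ intp pE] := is_cond_prob_eventX ellL.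
congr fine; rewrite -(setIT (eventX X ell)) -pE; last first.
  by exists setT => //; rewrite setTI.
rewrite -(integral_distribution (X := beta) (f := EFin \o cell_prob ell))//.
  by apply: eq_measure_integral => B mB _; exact/esym/beta_law.
by apply/measurable_EFinP; exact: measurable_cell_prob.
Qed.

(** The moment is the probability of the conditioning event, so it cancels the
    denominator of the conditional expectation.  For a null event the left side
    vanishes, and so does the integral over that event. *)
Lemma moment_cond_expect ell (f : borelV -> R) : (forall j, (ell j <= L j)%N) ->
  measurable_fun [set: borelV] f ->
  moment mu ell * cond_expect P (f \o beta) (eventX X ell) =
  \int[P]_w (f (beta w) * cell_prob ell (beta w)).
Proof.
move=> ellL mf; have mE := measurable_eventX ell.
have mfb : measurable_fun [set: Omega] (f \o beta) by exact: measurableT_comp.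
have <- : \int[P]_(w in eventX X ell) (f (beta w)) =
    \int[P]_w (f (beta w) * cell_prob ell (beta w)).
  congr fine; apply: integral_cond_prob => //.
  - exact: measurable_cell_prob.
  - by apply: filterS simplexL_ae => w; exact: cell_prob_ge0.
  - exact: is_cond_prob_eventX.
rewrite moment_eventX// /cond_expect.
have [PE0|PE0] := eqVneq (fine (P (eventX X ell))) 0; last by rewrite mulrC divfK.
rewrite PE0 mul0r /Rintegral null_set_integral//.
- by apply/measurable_EFinP; exact: measurable_funTS.
- by rewrite -[LHS]fineK ?fin_num_measure// PE0.
Qed.

End latent_class.


Theorem mainTheorem6 (R : realType) (J : nat) (L : 'I_J -> nat)
    (J_gt0 : (0 < J)%N) (L_gt0 : forall j, (0 < L j)%N)
    (mu : probability (borel_rV R (\sum_(j < J) L j)) R)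
    (mu_simplex : mu (@simplexL R J L) = 1%E)
    (d : measure_display) (Omega : measurableType d) (P : probability Omega R)
    (beta : {mfun Omega >-> borel_rV R (\sum_(j < J) L j)})
    (beta_law : forall B : set (borel_rV R (\sum_(j < J) L j)),
      measurable B -> distribution P beta B = mu B)
    (X : 'I_J -> {mfun Omega >-> nat})
    (X_range : forall j w, (1 <= X j w <= L j)%N)
    (X_given_beta : forall (j : 'I_J) (l : nat), (1 <= l <= L j)%N ->
      is_cond_prob P beta (X j @^-1` [set l]) (fun w => entry (beta w) j l))
    (G1 : cond_mutually_independent P beta X)
    (K : nat) (Q : {vspace 'rV[R]_(\sum_(j < J) L j)})
    (G2 : minimal_support mu K Q)
    (lambda : K.-tuple 'rV[R]_(\sum_(j < J) L j))
    (lambda_basis : basis_of Q lambda) :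
  forall (J' : nat) (v : 'I_K -> nat), (\sum_(k < K) v k)%N = J' ->
  forall (S : {set 'I_J}) (ell : 'I_J -> nat), indexL L S ell ->
  forall j : 'I_J, j \in S ->
  forall l : nat, (1 <= l <= L j)%N ->
  \sum_(k < K) entry (tnth lambda k) j l *
     (moment mu ell *
      cond_expect P (fun w => coord_monomial lambda (add_unit v k) (beta w))
        (eventX X ell)) =
  moment mu (add_at ell j l) *
    cond_expect P (fun w => coord_monomial lambda v (beta w))
      (eventX X (add_at ell j l)).
Proof.
move=> J' v _ S ell [ellL ellS] j jS l /andP[l0 lL].
have ellj : ell j = 0%N by apply/eqP; rewrite ellS.
have ell'L i : (add_at ell j l i <= L i)%N.
  rewrite /add_at; have [->|_] := eqVneq i j; first by rewrite ellj.
  by rewrite addn0.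
have simplex_ae := simplexL_ae beta_law mu_simplex.
pose g k w : R := entry (tnth lambda k) j l *
  (coord_monomial lambda (add_unit v k) (beta w) * cell_prob ell (beta w)).
have mb (f : borel_rV R (\sum_(j < J) L j) -> R) :
    measurable_fun [set: borel_rV R (\sum_(j < J) L j)] f ->
    measurable_fun [set: Omega] (fun w => f (beta w)).
  by move=> mf; exact: measurableT_comp.
have mprod k : measurable_fun [set: Omega] (fun w =>
    coord_monomial lambda (add_unit v k) (beta w) * cell_prob ell (beta w)).
  apply: measurable_funM; first exact: mb (measurable_coord_monomial _ _).
  exact: mb (measurable_cell_prob _).
have int_prod k : P.-integrable [set: Omega] (EFin \o (fun w =>
    coord_monomial lambda (add_unit v k) (beta w) * cell_prob ell (beta w))).
  have [M bM] := coord_monomial_bound lambda (add_unit v k).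
  apply: (ae_bounded_integrable (M := M)) => //.
  apply: filterS simplex_ae => w bS; rewrite normrM.
  have M1 : `|coord_monomial lambda (add_unit v k) (beta w)| <= M.
    by apply: bM => i; exact: simplexL_coord_le1.
  rewrite (le_trans _ M1)// ler_piMr// ger0_norm ?cell_prob_le1//.
  exact: cell_prob_ge0.
have int_g k : P.-integrable [set: Omega] (EFin \o g k).
  exact: (integrableZl measurableT _ (int_prod k)).
have -> : \sum_(k < K) entry (tnth lambda k) j l *
     (moment mu ell *
      cond_expect P (fun w => coord_monomial lambda (add_unit v k) (beta w))
        (eventX X ell)) = \sum_(k < K) \int[P]_w g k w.
  apply: eq_bigr => k _; rewrite RintegralZl//; congr (_ * _).
  have := moment_cond_expect beta_law X_given_beta G1 mu_simplex ellL
    (measurable_coord_monomial lambda (add_unit v k)).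
  exact.
have -> := moment_cond_expect beta_law X_given_beta G1 mu_simplex ell'L
  (measurable_coord_monomial lambda v).
have [_ muQ _] := G2.
have Q_ae := full_law_ae beta_law (measurable_vspace Q) muQ.
rewrite /Rintegral sum_fine; last first.
  by move=> k _; apply: integrable_fin_num => //; exact: int_g.
rewrite -integral_sum//.
congr fine; apply: ae_eq_integral => //.
- by apply: emeasurable_sum => k; apply/measurable_EFinP/measurable_funM.
- apply/measurable_EFinP/measurable_funM; first exact: mb (measurable_coord_monomial _ _).
  exact: mb (measurable_cell_prob _).
(* Almost surely beta is the combination of the lambda^k with coefficients
   G_k, and G^v * G_k is the monomial of exponent v + 1_k. *)
- apply: filterS Q_ae => w bQ _; rewrite sumEFin; congr EFin.
  rewrite (cell_prob_add_at _ ellj l0).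
  rewrite [X in entry X j l](coord_basis lambda_basis bQ) entry_sum.
  rewrite mulrA mulr_sumr mulr_suml; apply: eq_bigr => k _.
  by rewrite /g coord_monomialS (tnth_nth 0); ring.
Qed.
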